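(* Let $R_1,R_2,\ldots$ be independent nonnegative random variables with $E(R_i)=\mu>1$ ($\mu$ finite) for all $i\ge1$, and assume that all expectations involved exist. Define $$P_n=\prod_{i=1}^nR_i,\qquad S_n=P_n-E(P_n)=P_n-\mu^n,\quad n\ge1.$$ Then $\{S_n,\,n\ge1\}$ is a demimartingale.
   Context: Functions are understood to be Borel measurable. A sequence of $L^1$ random variables $(S_n)_{n\ge1}$ is a demimartingale if for all $j\ge1$, $E[(S_{j+1}-S_j)f(S_1,\ldots,S_j)]\ge 0$ for all componentwise nondecreasing functions $f:\mathbb{R}^j\to\mathbb{R}$ for which the expectation is defined. *)

(* Defs.v *)
From HB Require Import structures.
From mathcomp Require Import all_boot all_order all_algebra finmap.
From mathcomp Require Import all_classical all_reals all_analysis.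

Set Implicit Arguments.
Unset Strict Implicit.
Unset Printing Implicit Defensive.

Import Order.TTheory GRing.Theory Num.Theory.

Local Open Scope classical_set_scope.
Local Open Scope ring_scope.

(* Sequences are indexed by nat but only their terms of index >= 1 matter; the
   term of index 0 is never constrained nor used. *)

Definition mutually_independent (d : measure_display) (T : measurableType d)
    (R : realType) (P : probability T R) (I : choiceType) (D : set I)
    (X : I -> T -> R) : Prop :=
  forall (J : {fset I}) (B : I -> set R),
    [set` J] `<=` D ->
    (forall i, measurable (B i)) ->
    P (\bigcap_(i in [set` J]) X i @^-1` B i) =
    (\prod_(i <- J) P (X i @^-1` B i))%E.

(* 'E_P[Y] is meaningful in [-oo, +oo]: it is not of the form oo - oo (which
   the library's integral would send to -oo). *)
Definition expectation_defined (d : measure_display) (T : measurableType d)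
    (R : realType) (P : probability T R) (Y : T -> R) : Prop :=
  measurable_fun setT Y /\
  ((\int[P]_w (EFin \o Y)^\+ w < +oo)%E \/
   (\int[P]_w (EFin \o Y)^\- w < +oo)%E).

Definition tuple_nondecreasing (R : realType) (j : nat)
    (f : j.-tuple R -> R) : Prop :=
  forall x y : j.-tuple R,
    (forall i : 'I_j, tnth x i <= tnth y i) -> f x <= f y.

(* The sigma-algebra on j.-tuple R is the product one, i.e. the Borel
   sigma-algebra of R^j. *)
Definition demimartingale (d : measure_display) (T : measurableType d)
    (R : realType) (P : probability T R) (S : nat -> T -> R) : Prop :=
  (forall n, (1 <= n)%N -> S n \in Lfun P 1%E) /\
  (forall (j : nat) (f : j.-tuple R -> R), (1 <= j)%N ->
     measurable_fun setT f -> tuple_nondecreasing f ->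
     let Y := fun w => (S j.+1 w - S j w) * f [tuple S i.+1 w | i < j] in
     expectation_defined P Y -> (0 <= 'E_P[Y])%E).

Definition partial_prod (T : Type) (R : realType) (X : nat -> T -> R)
    (n : nat) : T -> R :=
  fun w => \prod_(1 <= i < n.+1) X i w.

(* Main.v *)
Require Import Defs.
From HB Require Import structures.
From mathcomp Require Import all_boot all_order all_algebra finmap.
From mathcomp Require Import all_classical all_reals all_analysis.
From mathcomp Require Import measurable_realfun.
From mathcomp Require Import ring lra.

(** Write P_n = X_1 ... X_n and Z_n = (X_1, ..., X_n). Since E P_n = mu^n by
    independence, the increment of S_n = P_n - mu^n is
    S_(n+1) - S_n = P_n (X_(n+1) - mu) + (mu - 1) (P_n - mu^n).
    It has to be tested against f(S_1, ..., S_n), which is a function g(Z_n)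
    that is nondecreasing on nonnegative tuples because every S_i is a
    nondecreasing function of the nonnegative variables X_1, ..., X_n.

    Suppose first that g is bounded. The two terms are handled separately.

    - [fluctuation_integral_ge0]: E[P_n (X_(n+1) - mu) g(Z_n, X_(n+1))] >= 0 for
      g nondecreasing in its last argument. With Z_n frozen, the integrand is
      at least P_n (X_(n+1) - mu) g(Z_n, mu), which has mean zero.
    - [harris_partial_prod]: E[(P_n - mu^n) g(Z_n)] >= 0, a case of the Harris
      (positive association) inequality. It follows by induction on n from
      P_(n+1) - mu^(n+1) = P_n (X_(n+1) - mu) + mu (P_n - mu^n): the first term
      is covered by the previous lemma, and in the second one freezing X_(n+1)
      leaves a nondecreasing function of Z_n.

    Freezing is Tonelli's theorem for the joint law of Z_n and X_(n+1), which
    is a product law ([independent_prefix_tuple], by uniqueness of measures on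
    the pi-system of boxes).

    For a general f, the function Y = (S_(n+1) - S_n) f(S_1, ..., S_n) need not
    be integrable. Truncating f at level k preserves monotonicity, so the
    truncated variable Y_k satisfies E Y_k^- <= E Y_k^+ <= E Y^+, and E Y_k^-
    increases to E Y^-. Hence E Y^- <= E Y^+, which gives E Y >= 0 as soon as
    one of the two is finite ([expectation_ge0_truncation]). *)

Set Implicit Arguments.
Unset Strict Implicit.
Unset Printing Implicit Defensive.

Import Order.TTheory GRing.Theory Num.Theory.

Local Open Scope classical_set_scope.
Local Open Scope ring_scope.

(** * Independent pairs and freezing *)

Section independence.
Context (d d1 d2 : measure_display) (T : measurableType d)
  (T1 : measurableType d1) (T2 : measurableType d2) (R : realType)
  (P : probability T R).

(** Two random elements are independent when their joint law agrees with the
    product of their laws on rectangles. *)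
Definition independent_rv (Z : T -> T1) (V : T -> T2) : Prop :=
  forall A B, measurable A -> measurable B ->
    (P (Z @^-1` A `&` V @^-1` B) = P (Z @^-1` A) * P (V @^-1` B))%E.

(** Freezing: the first component may be replaced by an independent copy, here
    realized on the same space by a second integration variable. *)
Lemma independent_tonelli (Z : {mfun T >-> T1}) (V : {mfun T >-> T2})
    (h : T1 * T2 -> \bar R) :
  independent_rv Z V -> measurable_fun setT h -> (forall x, 0 <= h x)%E ->
  (\int[P]_w h (Z w, V w) = \int[P]_u \int[P]_w h (Z u, V w))%E.
Proof.
move=> ZV mh h0.
have mZV : measurable_fun setT (fun w => (Z w, V w)).
  exact/measurable_fun_pair.
pose ZVm : {mfun T >-> (T1 * T2)%type} := HB.pack (fun w => (Z w, V w))
  (isMeasurableFun.Build _ _ _ _ _ mZV).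
transitivity (\int[distribution P ZVm]_x h x)%E.
  by rewrite ge0_integral_distribution.
transitivity (\int[(distribution P Z \x distribution P V)%E]_x h x)%E.
  apply: eq_measure_integral => A mA _; apply/esym.
  by apply: product_measure_unique => // B C; exact: ZV.
rewrite fubini_tonelli1//.
rewrite ge0_integral_distribution//=; last 2 first.
- exact: measurable_fun_fubini_tonelli_F.
- by move=> x; exact: integral_ge0.
apply: eq_integral => u _ /=.
rewrite /fubini_F ge0_integral_distribution//.
exact: measurableT_comp.
Qed.

Lemma integral_ge0_funepos_funeneg (Y : T -> R) :
  P.-integrable setT (EFin \o Y) ->
  (0 <= \int[P]_w (Y w)%:E)%E =
  (\int[P]_w (EFin \o Y)^\- w <= \int[P]_w (EFin \o Y)^\+ w)%E.
Proof.
move=> iY; rewrite integralE sube_ge0//.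
by apply/orP; left; exact: integrable_neg_fin_num iY.
Qed.

(** A sign-only form of Fubini's theorem for signed functions: if the mean is
    nonnegative for each frozen value of the first component, then so is the
    overall mean. *)
Lemma independent_integral_ge0 (Z : {mfun T >-> T1}) (V : {mfun T >-> T2})
    (h : T1 * T2 -> R) :
  independent_rv Z V -> measurable_fun setT h ->
  P.-integrable setT (fun w => (h (Z w, V w))%:E) ->
  (forall u, P.-integrable setT (fun w => (h (Z u, V w))%:E)) ->
  (forall u, 0 <= \int[P]_w (h (Z u, V w))%:E)%E ->
  (0 <= \int[P]_w (h (Z w, V w))%:E)%E.
Proof.
move=> ZV mh ih ihu hu.
rewrite (integral_ge0_funepos_funeneg ih).
have mE : measurable_fun setT (EFin \o h) by exact/measurable_EFinP.
have mp := measurable_funepos mE; have mn := measurable_funeneg mE.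
have Tp := independent_tonelli ZV mp (fun x => funepos_ge0 _ x).
have Tn := independent_tonelli ZV mn (fun x => funeneg_ge0 _ x).
rewrite (funeneg_comp (EFin \o h) (fun w => (Z w, V w))).
rewrite (funepos_comp (EFin \o h) (fun w => (Z w, V w))) /=.
rewrite Tp Tn.
(* both sides of the comparison below are measurable in the frozen variable *)
have mI (k : T1 * T2 -> \bar R) : measurable_fun [set: (T1 * T2)%type] k ->
    (forall x, 0 <= k x)%E ->
    measurable_fun [set: T] (fun u => \int[P]_w k (Z u, V w))%E.
  move=> mk k0; apply: (measurable_fun_fubini_tonelli_F
    (fun uw : T * T => k (Z uw.1, V uw.2))) => //.
  apply: (measurableT_comp mk); apply/measurable_fun_pair => /=;
    exact: measurableT_comp.
apply: ge0_le_integral => //.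
- by move=> u _; apply: integral_ge0.
- exact: mI.
- exact: mI.
- move=> u _; have := hu u.
  rewrite (integral_ge0_funepos_funeneg (ihu u)).
  rewrite (funeneg_comp (EFin \o h) (fun w => (Z u, V w))).
  by rewrite (funepos_comp (EFin \o h) (fun w => (Z u, V w))).
Qed.

End independence.

Lemma independent_rvC (d d1 d2 : measure_display) (T : measurableType d)
    (T1 : measurableType d1) (T2 : measurableType d2) (R : realType)
    (P : probability T R) (Z : T -> T1) (V : T -> T2) :
  independent_rv P Z V -> independent_rv P V Z.
Proof. by move=> ZV A B mA mB; rewrite setIC muleC ZV. Qed.

(** * Independence of a variable from the preceding ones *)

Section boxes.
Context (d : measure_display) (S : measurableType d) (n : nat).

(** The pi-system of boxes, i.e. products of measurable sets. *)
Definition measurable_boxes : set (set (n.-tuple S)) :=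
  [set A | exists2 C : 'I_n -> set S, (forall i, measurable (C i)) &
    A = [set t | forall i, C i (tnth t i)]].

Lemma measurable_tuple_boxes :
  @measurable _ (n.-tuple S) = <<s measurable_boxes >>.
Proof.
apply/seteqP; split.
  apply: smallest_sub; first exact: smallest_sigma_algebra.
  rewrite -bigcup_seq => A [i _ [B mB <-]].
  apply: sub_sigma_algebra.
  exists (fun j => if j == i then B else setT).
    by move=> j; case: ifP.
  apply/seteqP; split => [t [_ Bt] j|t Bt]; first by case: eqP => // ->.
  by split => //; have := Bt i; rewrite eqxx.
apply: smallest_sub; first exact: sigma_algebra_measurable.
move=> A [C mC ->].
rewrite (_ : [set _ | _] =
  \big[setI/setT]_(i < n) ((@tnth n S ^~ i) @^-1` C i)).
  apply: bigsetI_measurable => i _; rewrite -[X in measurable X]setTI.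
  exact: measurable_tnth.
rewrite -bigcap_seq; apply/seteqP; split => [t Ct i _|t Ct i]; first exact: Ct.
by apply: Ct; rewrite /= mem_index_enum.
Qed.

Lemma measurable_boxes_setI : setI_closed measurable_boxes.
Proof.
move=> _ _ [C mC ->] [D mD ->]; exists (fun i => C i `&` D i).
  by move=> i; exact: measurableI.
apply/seteqP; split => [t [Ct Dt] i|t CDt]; first by split.
by split => i; have [] := CDt i.
Qed.

End boxes.

Section prefix.
Context (R : realType) (d : measure_display) (T : measurableType d)
  (P : probability T R) (X : nat -> {RV P >-> R}).

(** The tuple (X_1, ..., X_n); the family is indexed from 1. *)
Definition prefix_tuple (n : nat) (w : T) : n.-tuple R :=
  [tuple X i.+1 w | i < n].

Lemma measurable_prefix_tuple n : measurable_fun setT (prefix_tuple n).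
Proof.
apply/measurable_fun_tnthP => i.
by rewrite (_ : _ \o _ = X i.+1)//; apply/funext => w /=; rewrite tnth_mktuple.
Qed.

HB.instance Definition _ n := isMeasurableFun.Build _ _ _ _ _
  (@measurable_prefix_tuple n).

Hypothesis X_indep : mutually_independent P [set i | (1 <= i)%N] X.

Let independent_box n (C : 'I_n -> set R) (B : set R) :
  (forall i, measurable (C i)) -> measurable B ->
  let A := [set t : n.-tuple R | forall i, C i (tnth t i)] in
  (P (prefix_tuple n @^-1` A `&` X n.+1 @^-1` B) =
   P (prefix_tuple n @^-1` A) * P (X n.+1 @^-1` B))%E.
Proof.
move=> mC mB A.
(* one family of sets, indexed like X, that packs C_0, ..., C_(n-1) and B *)
pose D (i : nat) : set R :=
  if i is k.+1 then if insub k is Some o then C o else B else setT.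
have mD i : measurable (D i) by case: i => [|k] /=; [|case: insub].
have DC (i : 'I_n) : D i.+1 = C i by rewrite /D valK.
have DB : D n.+1 = B by rewrite /D insubN// ltnn.
pose J := [fset i in iota 1 n]%fset.
have inJ i : (i \in J) = (1 <= i < n.+1)%N by rewrite !inE mem_iota add1n.
have nJ : n.+1 \notin J by rewrite inJ ltnn andbF.
have PA : prefix_tuple n @^-1` A = \bigcap_(i in [set` J]) X i @^-1` D i.
  apply/seteqP; split => [w Aw i|w Dw i].
    rewrite /= inJ; case: i => // k /=; rewrite ltnS => kn.
    by have := Aw (Ordinal kn); rewrite -DC tnth_mktuple.
  rewrite tnth_mktuple -DC; apply: Dw.
  by rewrite /= inJ /= ltnS.
rewrite PA X_indep//; last by move=> i /=; rewrite inJ => /andP[].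
rewrite muleC -[in RHS]DB.
rewrite -(@big_fsetU1 _ _ _ _ n.+1 J (fun i => P (X i @^-1` D i)) nJ)/=.
rewrite -X_indep//; last first.
  by move=> i /=; rewrite in_fset1U inJ => /orP[/eqP ->//|/andP[]].
congr (P _); apply/seteqP; split => [w [Dw Bw] i|w Dw].
  by move=> /fset1UP[->|Ji]; [rewrite DB|exact: Dw].
split; first by move=> i /= Ji; apply: Dw; rewrite /= in_fset1U Ji orbT.
by have := Dw n.+1; rewrite DB; apply; rewrite /= in_fset1U eqxx.
Qed.

(** For a fixed event on X_(n+1), the joint probability and the product of the
    probabilities are two finite measures of the event on (X_1, ..., X_n), and
    they agree on boxes. *)
Lemma independent_prefix_tuple n :
  independent_rv P (prefix_tuple n) (X n.+1).
Proof.
move=> A B mA mB.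
have mE : measurable (X n.+1 @^-1` B).
  by rewrite -[X in measurable X]setTI; exact: measurable_funPT.
have PE0 : 0 <= fine (P (X n.+1 @^-1` B)) by exact: fine_ge0.
have PEE : P (X n.+1 @^-1` B) = (NngNum PE0)%:num%:E.
  by rewrite /= fineK// fin_num_measure.
pose Z := prefix_tuple n.
have mZ : measurable_fun setT Z by exact: measurable_prefix_tuple.
rewrite PEE muleC.
pose m1 : {measure set (n.-tuple R) -> \bar R} := pushforward (mrestr P mE) Z.
pose m2 : {measure set (n.-tuple R) -> \bar R} :=
  mscale (NngNum PE0) (pushforward P Z).
suff : m1 mZ A = m2 mZ A by [].
apply: (measure_unique (@measurable_boxes _ R n) (fun=> setT)) => //.
- exact: measurable_tuple_boxes.
- exact: measurable_boxes_setI.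
- move=> _; exists (fun=> setT) => //.
  by apply/seteqP; split.
- by apply/seteqP; split => // x _; exists 0%N.
- move=> _ [C mC ->].
  by rewrite /= /mrestr /mscale -PEE muleC; exact: independent_box.
- move=> _; rewrite /= /pushforward /mrestr.
  by rewrite (le_lt_trans (probability_le1 _ _))// ?ltry// setTI.
Qed.

End prefix.

Arguments independent_prefix_tuple {R d T P X} X_indep n.
Arguments measurable_prefix_tuple {R d T P} X n.

(** * Tuples *)

Section tuples.
Context (R : realType).

(** The product P_n as a function of the tuple Z_n. *)
Definition tuple_prod n (z : n.-tuple R) : R := \prod_(i < n) tnth z i.

Definition tuple_snoc n (z : n.-tuple R) (r : R) : n.+1.-tuple R :=
  [tuple of rcons z r].

Lemma measurable_tuple_prod n : measurable_fun setT (@tuple_prod n).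
Proof.
by apply: measurable_prod => i _; exact: measurable_tnth.
Qed.

Lemma tnth_tuple_snoc n (z : n.-tuple R) r (i : 'I_n.+1) :
  tnth (tuple_snoc z r) i =
  if insub (i : nat) is Some j then tnth z j else r.
Proof.
rewrite (tnth_nth 0) /= nth_rcons size_tuple.
case: insubP => [j ij ji|]; first by rewrite ij (tnth_nth 0) ji.
rewrite -leqNgt => ni; rewrite ltnNge ni /=.
by rewrite (_ : _ == n) // eqn_leq ni -ltnS ltn_ord.
Qed.

Lemma measurable_tuple_snoc n :
  measurable_fun setT (fun zr : n.-tuple R * R => tuple_snoc zr.1 zr.2).
Proof.
apply/measurable_fun_tnthP => i.
rewrite (_ : _ \o _ = fun zr : n.-tuple R * R =>
  if insub (i : nat) is Some j then tnth zr.1 j else zr.2); last first.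
  by apply/funext => zr /=; exact: tnth_tuple_snoc.
case: insub => [j|]; last exact: measurable_snd.
exact: (measurableT_comp (measurable_tnth j)).
Qed.

(** The componentwise order restricted to nonnegative tuples, where products
    of components are monotone. *)
Definition nonneg_tuple_le n (x y : n.-tuple R) : Prop :=
  forall i, 0 <= tnth x i <= tnth y i.

Lemma nonneg_tuple_le_snoc n (x y : n.-tuple R) r s :
  nonneg_tuple_le x y -> 0 <= r <= s ->
  nonneg_tuple_le (tuple_snoc x r) (tuple_snoc y s).
Proof. by move=> xy rs i; rewrite !tnth_tuple_snoc; case: insub. Qed.

End tuples.

(** * The Harris inequality for partial products *)

Lemma integrable_mul_bounded (d : measure_display) (T : measurableType d)
    (R : realType) (m : {measure set T -> \bar R}) (f g : T -> R) (M : R) :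
  m.-integrable setT (EFin \o f) -> measurable_fun setT g ->
  (forall w, `|g w| <= M) -> m.-integrable setT (fun w => (f w * g w)%:E).
Proof.
move=> fi mg gM.
have mf : measurable_fun setT f.
  by apply/measurable_EFinP; exact: measurable_int fi.
apply: (le_integrable measurableT _ _ (integrableZl measurableT M fi)).
  by apply/measurable_EFinP; exact: measurable_funM.
move=> w _ /=; rewrite lee_fin !normrM mulrC ler_wpM2r//.
by rewrite (le_trans (gM w)) ?ler_norm.
Qed.

Section products.
Context (R : realType) (d : measure_display) (T : measurableType d)
  (P : probability T R) (X : nat -> {RV P >-> R}) (mu : R).

Local Notation Q := (partial_prod X).
Local Notation Z := (prefix_tuple X).

Lemma partial_prodS n w : Q n.+1 w = Q n w * X n.+1 w.
Proof. by rewrite /partial_prod big_nat_recr. Qed.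

Lemma tuple_prod_prefix n w : tuple_prod (Z n w) = Q n w.
Proof.
rewrite /partial_prod big_add1 big_mkord /tuple_prod.
by apply: eq_bigr => i _; rewrite tnth_mktuple.
Qed.

Lemma prefix_tupleS n w : Z n.+1 w = tuple_snoc (Z n w) (X n.+1 w).
Proof.
apply: eq_from_tnth => i; rewrite tnth_tuple_snoc tnth_mktuple.
case: insubP => [j ij ji|]; first by rewrite tnth_mktuple ji.
rewrite -leqNgt => ni; congr (X _ _); apply/eqP.
by rewrite eqSS eqn_leq ni -ltnS ltn_ord.
Qed.

Hypotheses (X_indep : mutually_independent P [set i | (1 <= i)%N] X)
  (X_ge0 : forall i, (1 <= i)%N -> forall w, 0 <= X i w)
  (X_int : forall i, (1 <= i)%N -> P.-integrable setT (EFin \o X i))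
  (X_mean : forall i, (1 <= i)%N -> (\int[P]_w (X i w)%:E = mu%:E)%E).

Lemma partial_prod_ge0 n w : 0 <= Q n w.
Proof.
by rewrite /partial_prod big_nat; apply: prodr_ge0 => i /andP[i1 _];
  exact: X_ge0.
Qed.

Lemma prefix_tuple_ge0 n w i : 0 <= tnth (Z n w) i.
Proof. by rewrite tnth_mktuple X_ge0. Qed.

Lemma mean_ge0 : 0 <= mu.
Proof.
rewrite -lee_fin -(X_mean (leqnn 1)); apply: integral_ge0 => w _.
by rewrite lee_fin X_ge0.
Qed.

Lemma measurable_partial_prod n : measurable_fun setT (Q n).
Proof.
by apply: measurable_prod => i _; exact: measurable_funPT.
Qed.

Lemma partial_prod_integral n : (\int[P]_w (Q n w)%:E = (mu ^+ n)%:E)%E.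
Proof.
elim: n => [|n IHn].
  under eq_integral do rewrite /partial_prod big_nil.
  by rewrite integral_cst//= probability_setT mule1.
(* the absolute value makes h nonnegative off the range of the variables *)
pose h (zr : n.-tuple R * R) : \bar R := `|tuple_prod zr.1 * zr.2|%:E.
have mh : measurable_fun setT h.
  apply/measurable_EFinP; apply: measurableT_comp => //.
  apply: measurable_funM => //.
  exact: (measurableT_comp (@measurable_tuple_prod R n)).
have hE u w : h (Z n u, X n.+1 w) = (Q n u * X n.+1 w)%:E.
  rewrite /h /= tuple_prod_prefix ger0_norm//.
  by rewrite mulr_ge0// ?partial_prod_ge0 ?X_ge0.
transitivity (\int[P]_w h (Z n w, X n.+1 w))%E.
  by apply: eq_integral => w _; rewrite hE partial_prodS.
rewrite (independent_tonelli (independent_prefix_tuple X_indep n))//;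
  last first.
  by move=> x; rewrite lee_fin.
transitivity (\int[P]_u ((Q n u)%:E * mu%:E))%E.
  apply: eq_integral => u _; under eq_integral do rewrite hE EFinM.
  rewrite ge0_integralZl//; first by rewrite X_mean.
  - exact/measurable_EFinP.
  - by move=> w _; rewrite lee_fin X_ge0.
  - by rewrite lee_fin partial_prod_ge0.
rewrite ge0_integralZr//; last 3 first.
- by apply/measurable_EFinP; exact: measurable_partial_prod.
- by move=> w _; rewrite lee_fin partial_prod_ge0.
- by rewrite lee_fin mean_ge0.
by rewrite IHn -EFinM exprSr.
Qed.

Lemma integrable_partial_prod n : P.-integrable setT (EFin \o Q n).
Proof.
apply/integrableP; split.
  by apply/measurable_EFinP; exact: measurable_partial_prod.
rewrite (_ : (\int[P]_w _)%E = (mu ^+ n)%:E) ?ltry//.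
rewrite -partial_prod_integral; apply: eq_integral => w _ /=.
by rewrite ger0_norm// partial_prod_ge0.
Qed.

Lemma integrable_fluctuation n :
  P.-integrable setT (EFin \o (fun w => Q n w * (X n.+1 w - mu))).
Proof.
rewrite (_ : EFin \o _ =
  (EFin \o Q n.+1) \- (fun w => mu%:E * (EFin \o Q n) w))%E; last first.
  by apply/funext => w; rewrite /= partial_prodS; congr EFin; ring.
apply: integrableB => //; first exact: integrable_partial_prod.
by apply: integrableZl => //; exact: integrable_partial_prod.
Qed.

Lemma integrable_centered n :
  P.-integrable setT (EFin \o (fun w => Q n w - mu ^+ n)).
Proof.
rewrite (_ : EFin \o _ = (EFin \o Q n) \- (EFin \o cst (mu ^+ n)%R))%E//.
apply: integrableB => //; first exact: integrable_partial_prod.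
exact: finite_measure_integrable_cst.
Qed.

(** Given Z_n, this says that X_(n+1) and a nondecreasing function of it are
    nonnegatively correlated: compare g (Z_n, X_(n+1)) with g (Z_n, mu). *)
Lemma fluctuation_integral_ge0 n (g : n.-tuple R * R -> R) (M : R) :
  measurable_fun setT g -> (forall x, `|g x| <= M) ->
  (forall z r s, (forall i, 0 <= tnth z i) -> 0 <= r <= s ->
    g (z, r) <= g (z, s)) ->
  (0 <= \int[P]_w (Q n w * (X n.+1 w - mu) * g (Z n w, X n.+1 w))%:E)%E.
Proof.
move=> mg gM g_nd.
have mZV : measurable_fun setT (fun w => (Z n w, X n.+1 w)).
  by apply/measurable_fun_pair => //; exact: (measurable_prefix_tuple X n).
pose h (zr : n.-tuple R * R) := tuple_prod zr.1 * (zr.2 - mu) * g zr.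
have mh : measurable_fun setT h.
  apply: measurable_funM => //; apply: measurable_funM.
    exact: (measurableT_comp (@measurable_tuple_prod R n)).
  exact: measurable_funB.
have hE u w : h (Z n u, X n.+1 w) =
    (X n.+1 w - mu) * g (Z n u, X n.+1 w) * Q n u.
  by rewrite /h /= tuple_prod_prefix; ring.
have i1 : P.-integrable setT (EFin \o (fun w => X n.+1 w - mu)).
  rewrite (_ : EFin \o _ = (EFin \o X n.+1) \- (EFin \o cst mu))%E//.
  apply: integrableB => //; first exact: X_int.
  exact: finite_measure_integrable_cst.
have c0 : (\int[P]_w (X n.+1 w - mu)%:E = 0)%E.
  under eq_integral do rewrite EFinB.
  rewrite integralB_EFin//; last 2 first.
  - exact: X_int.
  - exact: finite_measure_integrable_cst.
  by rewrite X_mean// integral_cst//= probability_setT mule1 subee.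
have mgu u : measurable_fun setT (fun w => g (Z n u, X n.+1 w)).
  apply: (measurableT_comp mg); apply/measurable_fun_pair => //.
have ihu u : P.-integrable setT (fun w => (h (Z n u, X n.+1 w))%:E).
  under eq_fun do rewrite hE.
  apply: (integrable_mul_bounded (M := `|Q n u|)) => //.
  exact: (integrable_mul_bounded i1 (mgu u) (fun w => gM (Z n u, X n.+1 w))).
suff : (0 <= \int[P]_w (h (Z n w, X n.+1 w))%:E)%E.
  by under eq_integral do rewrite /h /= tuple_prod_prefix.
apply: (independent_integral_ge0 (independent_prefix_tuple X_indep n)) => //.
- rewrite (_ : (fun w => _) = fun w =>
    (Q n w * (X n.+1 w - mu) * g (Z n w, X n.+1 w))%:E); last first.
    by apply/funext => w; rewrite /h /= tuple_prod_prefix.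
  apply: (integrable_mul_bounded (integrable_fluctuation n) _
    (fun w => gM (Z n w, X n.+1 w))).
  exact: measurableT_comp.
move=> u.
have -> : (0 = \int[P]_w ((Q n u * g (Z n u, mu))%:E * (X n.+1 w - mu)%:E))%E.
  by rewrite integralZl// c0 mule0.
(* pointwise, since X_(n+1) - mu and g (z, X_(n+1)) - g (z, mu) have the same
   sign *)
apply: le_integral => //.
- exact: integrableZl.
- exact: ihu.
move=> w _; rewrite -EFinM lee_fin hE.
rewrite -subr_ge0 (_ : _ - _ = Q n u *
  ((X n.+1 w - mu) * (g (Z n u, X n.+1 w) - g (Z n u, mu)))); last by ring.
apply: mulr_ge0; first exact: partial_prod_ge0.
have [Xm|/ltW Xm] := leP mu (X n.+1 w).
  by rewrite mulr_ge0// subr_ge0// g_nd// ?mean_ge0// => i;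
    exact: prefix_tuple_ge0.
by rewrite mulr_le0// subr_le0// g_nd// ?X_ge0// => i; exact: prefix_tuple_ge0.
Qed.

(** P_n and g(Z_n) are nonnegatively correlated. *)
Lemma harris_partial_prod n (g : n.-tuple R -> R) (M : R) :
  measurable_fun setT g -> (forall z, `|g z| <= M) ->
  (forall x y, nonneg_tuple_le x y -> g x <= g y) ->
  (0 <= \int[P]_w ((Q n w - mu ^+ n) * g (Z n w))%:E)%E.
Proof.
elim: n g => [|n IHn] g mg gM g_nd.
  rewrite integral0_eq// => w _.
  by rewrite /partial_prod big_nil expr0 subrr mul0r.
pose gs (zr : n.-tuple R * R) := g (tuple_snoc zr.1 zr.2).
have mgs : measurable_fun setT gs.
  by apply: (measurableT_comp mg); exact: measurable_tuple_snoc.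
have mZ := measurable_prefix_tuple X n.
have mG : measurable_fun setT (fun w => gs (Z n w, X n.+1 w)).
  by apply: (measurableT_comp mgs); exact/measurable_fun_pair.
have iA := integrable_mul_bounded (integrable_fluctuation n) mG (fun w => gM _).
have iB := integrable_mul_bounded (integrable_centered n) mG (fun w => gM _).
under eq_integral => w _.
  rewrite (_ : _ * _ = Q n w * (X n.+1 w - mu) * gs (Z n w, X n.+1 w) +
    mu * ((Q n w - mu ^+ n) * gs (Z n w, X n.+1 w))); last first.
    by rewrite partial_prodS prefix_tupleS exprS /gs /=; ring.
  rewrite EFinD [X in (_ + X)%E]EFinM.
  over.
rewrite integralD//; last exact: integrableZl.
rewrite integralZl//; apply: adde_ge0.
  apply: (@fluctuation_integral_ge0 n gs M) => //; first by move=> z; exact: gM.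
  by move=> z r s z0 rs; apply: g_nd; apply: nonneg_tuple_le_snoc => // i;
    rewrite z0 lexx.
apply: mule_ge0; first by rewrite lee_fin mean_ge0.
(* X_(n+1) comes first here, as it is the component to be frozen *)
pose h (rz : R * n.-tuple R) := (tuple_prod rz.2 - mu ^+ n) * gs (rz.2, rz.1).
have mh : measurable_fun setT h.
  apply: measurable_funM.
    apply: measurable_funB => //.
    exact: (measurableT_comp (@measurable_tuple_prod R n)).
  by apply: (measurableT_comp mgs); exact/measurable_fun_pair.
have hE u w : h (X n.+1 u, Z n w) =
    (Q n w - mu ^+ n) * g (tuple_snoc (Z n w) (X n.+1 u)).
  by rewrite /h /= tuple_prod_prefix.
have mgr r : measurable_fun setT (fun z : n.-tuple R => g (tuple_snoc z r)).
  suff : measurable_fun setT (gs \o (fun z => (z, r))) by [].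
  by apply: measurableT_comp => //; exact/measurable_fun_pair.
have -> : (\int[P]_w ((Q n w - mu ^+ n) * gs (Z n w, X n.+1 w))%:E =
    \int[P]_w (h (X n.+1 w, Z n w))%:E)%E.
  by apply: eq_integral => w _; rewrite hE.
apply: (independent_integral_ge0
  (independent_rvC (independent_prefix_tuple X_indep n))) => //.
- by under eq_fun do rewrite hE.
- move=> u; under eq_fun do rewrite hE.
  apply: (integrable_mul_bounded (integrable_centered n) _ (fun w => gM _)).
  exact: (measurableT_comp (mgr (X n.+1 u))).
move=> u; under eq_integral do rewrite hE.
apply: (IHn (fun z => g (tuple_snoc z (X n.+1 u)))); [exact: mgr|by []|].
by move=> x y xy; apply: g_nd; apply: nonneg_tuple_le_snoc => //;
  rewrite lexx X_ge0.
Qed.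

End products.

(** * Truncation *)

Section clamp.
Context (R : realType).

(** Truncation of x to the interval from -k to k; meaningful for 0 <= k. *)
Definition clamp (k x : R) : R := Num.max (- k) (Num.min x k).

Lemma clamp_cases k x : 0 <= k ->
  [\/ x <= - k /\ clamp k x = - k, (- k <= x <= k) /\ clamp k x = x |
      k <= x /\ clamp k x = k].
Proof.
rewrite /clamp => k0; case: (ltP x k) => xk.
  by case: (ltP (- k) x) => kx; [apply: Or32|apply: Or31]; split => //; lra.
by case: (ltP (- k) k) => kk; apply: Or33; split => //; lra.
Qed.

Lemma clamp_le k x y : 0 <= k -> x <= y -> clamp k x <= clamp k y.
Proof.
move=> k0 xy.
by case: (clamp_cases x k0) => -[? ->];
  case: (clamp_cases y k0) => -[? ->]; lra.
Qed.

Lemma norm_clamp k x : 0 <= k -> `|clamp k x| <= k.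
Proof.
by move=> k0; rewrite ler_norml; case: (clamp_cases x k0) => -[? ->]; lra.
Qed.

Lemma clamp_id k x : `|x| <= k -> clamp k x = x.
Proof.
move=> xk; have k0 : 0 <= k by exact: le_trans xk.
by move: xk; rewrite ler_norml; case: (clamp_cases x k0) => -[? ->]; lra.
Qed.

Lemma clamp_clamp a b x : 0 <= a <= b -> clamp a (clamp b x) = clamp a x.
Proof.
move=> /andP[a0 ab]; have b0 := le_trans a0 ab.
by case: (clamp_cases (clamp b x) a0) => -[+ ->];
  case: (clamp_cases x b0) => -[? ->]; case: (clamp_cases x a0) => -[? ->]; lra.
Qed.

(** Truncating a factor decreases the positive part of a product. Used with c
    and - c, it compares both parts. *)
Lemma max0_mul_clamp_le k x c : 0 <= k ->
  Num.max (c * clamp k x) 0 <= Num.max (c * x) 0.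
Proof.
move=> k0; rewrite ge_max !le_max lexx orbT andbT; apply/orP.
case: (clamp_cases x k0) => -[xk ->]; [|by left|].
  by case: (leP 0 c) => c0; [right|left]; nra.
by case: (leP 0 c) => c0; [left|right]; nra.
Qed.

Lemma measurable_clamp k : measurable_fun setT (clamp k).
Proof. by apply: measurable_maxr => //; exact: measurable_minr. Qed.

End clamp.

(** An expectation that is defined, possibly infinite, is nonnegative as soon
    as it is nonnegative for every truncation of one of the factors. *)
Lemma expectation_ge0_truncation (R : realType) (d : measure_display)
    (T : measurableType d) (P : probability T R) (D G : T -> R) :
  (forall k : nat, P.-integrable setT (fun w => (D w * clamp k%:R (G w))%:E)) ->
  (forall k : nat, (0 <= \int[P]_w (D w * clamp k%:R (G w))%:E)%E) ->
  expectation_defined P (fun w => D w * G w) ->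
  (0 <= 'E_P[fun w => (D w * G w)%R])%E.
Proof.
move=> ik k0 [mY fin].
pose Y w := D w * G w; pose Yk (k : nat) w := D w * clamp k%:R (G w).
have mYk k : measurable_fun setT (EFin \o Yk k) by exact: measurable_int (ik k).
have mYE : measurable_fun setT (EFin \o Y) by exact/measurable_EFinP.
have posE (f : T -> R) w : (EFin \o f)^\+%E w = (Num.max (f w) 0)%:E.
  by rewrite funeposE EFin_max.
have negE (f : T -> R) w : (EFin \o f)^\-%E w = (Num.max (- f w) 0)%:E.
  by rewrite funenegE EFin_max.
have negP_le k :
    (\int[P]_w (EFin \o Yk k)^\- w <= \int[P]_w (EFin \o Y)^\+ w)%E.
  apply: (@le_trans _ _ (\int[P]_w (EFin \o Yk k)^\+ w)%E).
    by rewrite -(integral_ge0_funepos_funeneg (ik k)).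
  apply: ge0_le_integral => //; [exact: measurable_funepos|
    exact: measurable_funepos|].
  by move=> w _; rewrite !posE lee_fin max0_mul_clamp_le.
have lim_neg w : limn (fun k => (EFin \o Yk k)^\- w)%E = (EFin \o Y)^\-%E w.
  apply: lim_near_cst => //; near=> k.
  by rewrite !negE /Yk clamp_id//; near: k; exact: nbhs_infty_ger.
have neg_nd w :
    {homo (fun k => (EFin \o Yk k)^\-%E w) : a b / (a <= b)%N >-> (a <= b)%E}.
  move=> a b ab; rewrite !negE lee_fin /Yk.
  rewrite -(@clamp_clamp _ a%:R b%:R) ?ler0n ?ler_nat//.
  by rewrite -!mulNr max0_mul_clamp_le.
have neg_le : (\int[P]_w (EFin \o Y)^\- w <= \int[P]_w (EFin \o Y)^\+ w)%E.
  (* E Y^- is the limit of the E Y_k^-, all of them at most E Y^+ *)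
  under eq_integral do rewrite -lim_neg.
  rewrite monotone_convergence//; last by move=> k; exact: measurable_funeneg.
  apply: lime_le; last by apply: nearW => k; exact: negP_le.
  apply: ereal_nondecreasing_is_cvgn => a b ab.
  apply: ge0_le_integral => //; [exact: measurable_funeneg|
    exact: measurable_funeneg|].
  by move=> w _; exact: neg_nd.
rewrite unlock integralE sube_ge0//.
case: fin => fin; apply/orP; [right|left];
  rewrite ge0_fin_numE//; exact: integral_ge0.
Unshelve. all: by end_near. Qed.

(** * Increments of the centered partial products *)

Section centered_tuple.
Context (R : realType) (mu : R) (n : nat).

(** The map taking (X_1, ..., X_n) to (S_1, ..., S_n); component i, counted
    from 0, is the product of the first i.+1 entries minus mu ^+ i.+1. *)
Definition centered_products (z : n.-tuple R) : n.-tuple R :=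
  [tuple \prod_(k < n | (k <= i)%N) tnth z k - mu ^+ i.+1 | i < n].

Lemma measurable_centered_products : measurable_fun setT centered_products.
Proof.
apply/measurable_fun_tnthP => i.
rewrite (_ : _ \o _ =
  fun z => \prod_(k < n | (k <= i)%N) tnth z k - mu ^+ i.+1); last first.
  by apply/funext => z /=; rewrite tnth_mktuple.
apply: measurable_funB => //.
rewrite (_ : (fun z : n.-tuple R => \prod_(k < n | (k <= i)%N) tnth z k) =
  fun z => \prod_(k < n) if (k <= i)%N then tnth z k else 1); last first.
  by apply/funext => z; exact: big_mkcond.
apply: measurable_prod => k _; case: (k <= i)%N => //; exact: measurable_tnth.
Qed.

Lemma centered_products_le (x y : n.-tuple R) i : nonneg_tuple_le x y ->
  tnth (centered_products x) i <= tnth (centered_products y) i.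
Proof.
by move=> xy; rewrite !tnth_mktuple lerB//; exact: ler_prod.
Qed.

End centered_tuple.

Section products.
Context (R : realType) (d : measure_display) (T : measurableType d)
  (P : probability T R) (X : nat -> {RV P >-> R}) (mu : R).

Local Notation Q := (partial_prod X).
Local Notation Z := (prefix_tuple X).

Lemma centered_products_prefix n w :
  centered_products mu (Z n w) = [tuple Q i.+1 w - mu ^+ i.+1 | i < n].
Proof.
apply: eq_from_tnth => i; rewrite !tnth_mktuple; congr (_ - _).
rewrite /partial_prod big_add1 big_mkord.
rewrite (big_ord_widen_cond n xpredT (fun k => X k.+1 w)) /=; last first.
  exact: ltn_ord.
by apply: eq_bigr => k _; rewrite tnth_mktuple.
Qed.

Hypotheses (X_indep : mutually_independent P [set i | (1 <= i)%N] X)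
  (X_ge0 : forall i, (1 <= i)%N -> forall w, 0 <= X i w)
  (X_int : forall i, (1 <= i)%N -> P.-integrable setT (EFin \o X i))
  (X_mean : forall i, (1 <= i)%N -> (\int[P]_w (X i w)%:E = mu%:E)%E).

Let D n w := (Q n.+1 w - mu ^+ n.+1) - (Q n w - mu ^+ n).

Lemma integrable_increment n : P.-integrable setT (EFin \o D n).
Proof.
rewrite (_ : EFin \o _ = (EFin \o (fun w => Q n.+1 w - mu ^+ n.+1)%R) \-
  (EFin \o (fun w => Q n w - mu ^+ n)%R))%E//.
by apply: integrableB => //; exact: integrable_centered.
Qed.

(** The demimartingale inequality for bounded test functions. *)
Lemma increment_integral_ge0 n (g : n.-tuple R -> R) (M : R) :
  1 <= mu -> measurable_fun setT g -> (forall z, `|g z| <= M) ->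
  (forall x y, nonneg_tuple_le x y -> g x <= g y) ->
  (0 <= \int[P]_w (D n w * g (Z n w))%:E)%E.
Proof.
move=> mu1 mg gM g_nd.
have mG : measurable_fun setT (fun w => g (Z n w)).
  by apply: (measurableT_comp mg); exact: measurable_prefix_tuple.
have iA := integrable_mul_bounded
  (integrable_fluctuation X_indep X_ge0 X_mean n) mG (fun w => gM _).
have iB := integrable_mul_bounded
  (integrable_centered X_indep X_ge0 X_mean n) mG (fun w => gM _).
under eq_integral => w _.
  rewrite (_ : _ * _ = Q n w * (X n.+1 w - mu) * g (Z n w) +
    (mu - 1) * ((Q n w - mu ^+ n) * g (Z n w))); last first.
    by rewrite /D partial_prodS exprS /=; ring.
  rewrite EFinD [X in (_ + X)%E]EFinM.
  over.
rewrite integralD//; last exact: integrableZl.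
rewrite integralZl//; apply: adde_ge0.
  apply: (fluctuation_integral_ge0 X_indep X_ge0 X_int X_mean
    (g := fun zr => g zr.1) (M := M)) => //.
  exact: measurableT_comp.
apply: mule_ge0; first by rewrite lee_fin subr_ge0.
exact: (harris_partial_prod X_indep X_ge0 X_int X_mean mg gM g_nd).
Qed.

End products.

Theorem proposition1p10 (R : realType) (d : measure_display)
    (T : measurableType d) (P : probability T R)
    (X : nat -> {RV P >-> R}) (mu : R)
    (mu_gt1 : 1 < mu)
    (X_indep : mutually_independent P [set i | (1 <= i)%N] X)
    (X_ge0 : forall i, (1 <= i)%N -> forall w, 0 <= X i w)
    (X_L1 : forall i, (1 <= i)%N -> (X i : T -> R) \in Lfun P 1%E)
    (X_mean : forall i, (1 <= i)%N -> ('E_P[X i] = mu%:E)%E) :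
  (forall n, (1 <= n)%N -> ('E_P[partial_prod X n] = (mu ^+ n)%:E)%E) /\
  demimartingale P
    (fun n w => partial_prod X n w - fine 'E_P[partial_prod X n]%E).
Proof.
have X_int i : (1 <= i)%N -> P.-integrable setT (EFin \o X i).
  by move=> i1; apply/Lfun1_integrable; exact: X_L1.
have X_mean' i : (1 <= i)%N -> (\int[P]_w (X i w)%:E = mu%:E)%E.
  by move=> i1; rewrite -(X_mean i i1) unlock.
have EQ n : ('E_P[partial_prod X n] = (mu ^+ n)%:E)%E.
  by rewrite unlock; exact: partial_prod_integral.
split=> [n _|]; first exact: EQ.
under [X in demimartingale _ X]eq_fun => n do rewrite EQ /=.
split=> [n _|j f _ mf f_nd Y Ydef].
  by apply/Lfun1_integrable; exact: (integrable_centered X_indep).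
pose G w := f (centered_products mu (prefix_tuple X j w)).
pose D w :=
  (partial_prod X j.+1 w - mu ^+ j.+1) - (partial_prod X j w - mu ^+ j).
have mc := measurableT_comp mf (@measurable_centered_products R mu j).
have YE : Y = fun w => D w * G w.
  by apply/funext => w; rewrite /Y /G centered_products_prefix.
rewrite YE in Ydef *.
have iD : P.-integrable setT (EFin \o D).
  exact: (integrable_increment X_indep).
have mck (k : nat) := measurableT_comp (@measurable_clamp R k%:R) mc.
apply: expectation_ge0_truncation => //.
- move=> k; apply: (integrable_mul_bounded (M := k%:R) iD).
    exact: (measurableT_comp (mck k) (measurable_prefix_tuple X j)).
  by move=> w; apply: norm_clamp.
- move=> k; apply: (increment_integral_ge0 X_indep X_ge0 X_int X_mean'
    (g := fun z => clamp k%:R (f (centered_products mu z))) (M := k%:R)) => //.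
  + exact: ltW.
  + exact: mck.
  + by move=> z; apply: norm_clamp.
  + move=> x y xy; apply: clamp_le => //; apply: f_nd => i.
    exact: centered_products_le.
Qed.
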